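(* Let $\rho,\sigma$ be density matrices on a finite-dimensional Hilbert space with $\rho\succ\sigma$, and put $\Delta M_n=M^{(n)}(\sigma;n-1)-M^{(n)}(\rho;n-1)$ for $n=1,2,3$. Assume $\Delta M_1\neq 0$. Then $$\Delta M_3\ \ge\ 3\,\Delta M_2+\frac34\,\frac{(\Delta M_2)^2}{\Delta M_1}.$$
   Context: For an integer $n\ge 1$ and a density matrix $\rho$, $M^{(n)}(\rho;n-1)=\mathrm{Tr}\big[\rho(-\ln\rho+n-1)^n\big]-(n-1)^n$ (zero eigenvalues contribute $0$ to the trace). Majorization: for density matrices $\rho_1,\rho_2$ of the same dimension $d$ with eigenvalues in decreasing order $\lambda_1\ge\dots\ge\lambda_d$ and $\kappa_1\ge\dots\ge\kappa_d$, $\rho_1\succ\rho_2$ means $\sum_{k=1}^m\lambda_k\ge\sum_{k=1}^m\kappa_k$ for all $m=1,\dots,d$. *)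

(* Defs.v *)
From HB Require Import structures.
From mathcomp Require Import all_boot all_order all_algebra.
From mathcomp Require Import spectral.
From mathcomp Require Import complex.
From mathcomp Require Import reals exp.

Set Implicit Arguments.
Unset Strict Implicit.
Unset Printing Implicit Defensive.

Import Order.TTheory GRing.Theory Num.Theory.
Local Open Scope ring_scope.
Local Open Scope complex_scope.
Local Open Scope sesquilinear_scope.

Section DensityMatrices.
Variables (R : realType) (d : nat).
Implicit Types (A rho sigma : 'M[R[i]]_d).

(* In the order of R[i], 0 <= z means that z is real and nonnegative. *)
Definition posSemidef A : Prop :=
  A \is hermsymmx /\ forall v : 'cV[R[i]]_d, 0 <= (v ^t* *m A *m v) 0 0.

Definition densityMatrix rho : Prop := posSemidef rho /\ \tr rho = 1.

(* Meaningful for Hermitian A: then A = U^-1 *m diag_mx D *m U, where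
   U = spectralmx A is unitary and the row D = spectral_diag A is real. *)
Definition funMx (f : R -> R) A : 'M[R[i]]_d :=
  invmx (spectralmx A)
    *m diag_mx (\row_j (f (complex.Re (spectral_diag A 0 j)))%:C)
    *m spectralmx A.

(* ln is total with ln 0 = 0, so logMx rho vanishes on the kernel of rho. *)
Definition logMx A : 'M[R[i]]_d := funMx (@ln R) A.

(* M^(n)(rho; n-1), for n >= 1. As rho multiplies the n-th power, which is
   finite on the kernel of rho, zero eigenvalues contribute 0 to the trace. *)
Definition entropyMoment (n : nat) rho : R :=
  complex.Re (\tr (rho *m (- logMx rho + (n%:R - 1)%:M) ^+ n)) - (n%:R - 1) ^+ n.

(* Eigenvalues of a Hermitian matrix, with multiplicity, in decreasing order. *)
Definition eigenvalues A : seq R :=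
  sort (fun x y => y <= x)
    [seq complex.Re (spectral_diag A 0 j) | j <- enum 'I_d].

Definition majorizes rho sigma : Prop :=
  forall m : nat, (1 <= m <= d)%N ->
    \sum_(0 <= k < m) (eigenvalues sigma)`_k
      <= \sum_(0 <= k < m) (eigenvalues rho)`_k.

End DensityMatrices.

(* Main.v *)
Require Import Defs.
From mathcomp Require Import all_boot all_order all_algebra.
From mathcomp Require Import complex reals.
From mathcomp Require Import spectral.
From mathcomp Require Import topology normedtype derive exp.
From mathcomp Require Import ring lra.

Set Implicit Arguments.
Unset Strict Implicit.
Unset Printing Implicit Defensive.

Import Order.TTheory GRing.Theory Num.Theory.
Import numFieldNormedType.Exports.
Local Open Scope ring_scope.

(* Put t = DeltaM 2 / DeltaM 1. The claim is that g = x p(-ln x), with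
   p(L) = (L+2)^3 - 3 (L+1)^2 - (3/2) t (L+1)^2 + (3/4) t^2 L, has a larger
   trace at sigma than at rho. Since (x p(-ln x))'' = -(p' - p'')(-ln x) / x and
   p' - p'' = 3 (L - t/2)^2, g is concave, so this is Karamata's inequality for
   the majorization of spectra. Up to a multiple of x, whose traces agree,
   g is normalized so that g' = (s - ln x)^3 with s = - t/2. *)

(** * Tangent inequality for the concave cubic entropy *)

Lemma ler_cube (R : realDomainType) (x y : R) : x <= y -> x ^+ 3 <= y ^+ 3.
Proof.
move=> lexy; rewrite -subr_ge0.
have -> : y ^+ 3 - x ^+ 3 = (y - x) * (y ^+ 2 + x * y + x ^+ 2) by ring.
by apply: mulr_ge0; [rewrite subr_ge0 | nra].
Qed.

(** The factor [x] makes the value at [x = 0] equal to [0], the limit from the right, whatever value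
    [ln 0] has. *)
Definition cubicEntropy (R : realType) (s x : R) : R :=
  x * ((s - ln x) ^+ 3 + 3 * (s - ln x) ^+ 2 + 6 * (s - ln x) + 6).

Lemma is_derive_cubicEntropy (R : realType) (s x : R) : 0 < x ->
  is_derive x 1 (cubicEntropy s) ((s - ln x) ^+ 3).
Proof.
move=> x_gt0; have dln := is_derive1_ln x_gt0.
rewrite /cubicEntropy; apply: is_derive_eq.
rewrite /GRing.scale /=; field; exact: lt0r_neq0.
Qed.

Lemma cubicEntropy_MVT (R : realType) (s a b : R) : 0 < a -> a <= b ->
  exists2 c, a <= c <= b &
    cubicEntropy s b - cubicEntropy s a = (s - ln c) ^+ 3 * (b - a).
Proof.
move=> a_gt0 leab.
have dg x : a <= x -> is_derive x 1 (cubicEntropy s) ((s - ln x) ^+ 3).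
  by move=> leax; apply: is_derive_cubicEntropy; apply: lt_le_trans leax.
have [||c] := @MVT_segment R (cubicEntropy s) (fun x => (s - ln x) ^+ 3) _ _ leab.
- by move=> x; rewrite in_itv /= => /andP[/ltW/dg].
- apply: derivable_within_continuous => x; rewrite in_itv /= => /andP[/dg dgx _].
  exact: ex_derive.
by rewrite in_itv /= => cab eq; exists c.
Qed.

(** The slope [(s - ln x) ^+ 3] decreases, so the mean value theorem compares a chord with the
    tangent. As it is unbounded near [0], the point of tangency is positive, while [y] may be a zero
    eigenvalue. *)
Lemma cubicEntropy_tangent (R : realType) (s x y : R) : 0 < x -> 0 <= y ->
  cubicEntropy s y <= cubicEntropy s x + (s - ln x) ^+ 3 * (y - x).
Proof.
(* At [y = 0] the mean value theorem above does not apply; there the gap is computed explicitly and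
   is a positive multiple of a sum of squares. *)
move=> x_gt0; rewrite le_eqVlt => /predU1P[<-|y_gt0].
  rewrite /cubicEntropy mul0r -subr_ge0.
  set u := s - ln x.
  have -> : x * (u ^+ 3 + 3 * u ^+ 2 + 6 * u + 6) + u ^+ 3 * (0 - x) - 0
      = 3 * x * ((u + 1) ^+ 2 + 1) by ring.
  by rewrite !mulr_ge0 ?addr_ge0 ?sqr_ge0 // ltW.
rewrite -lerBlDl; have [lexy|/ltW leyx] := leP x y.
  have [c /andP[lexc _] ->] := cubicEntropy_MVT s x_gt0 lexy.
  rewrite ler_wpM2r ?subr_ge0 // ler_cube // lerD2l lerN2 ler_ln ?posrE //.
  exact: lt_le_trans lexc.
have [c /andP[leyc lecx] eq] := cubicEntropy_MVT s y_gt0 leyx.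
rewrite -[leLHS]opprB eq -mulrN opprB ler_wnM2r ?subr_le0 //.
rewrite ler_cube // lerD2l lerN2 ler_ln ?posrE //; exact: lt_le_trans leyc.
Qed.

(** * Abel summation and Karamata's inequality *)

(** Abel summation, done by induction: in front of a nonpositive partial sum, raising the
    coefficient from [c n] to [c n.+1] only lowers the product. *)
Lemma sumrM_ge_partial_sums (R : realDomainType) (c e : nat -> R) (n : nat) :
  (forall i, (i < n)%N -> c i <= c i.+1) ->
  (forall m, (m <= n)%N -> \sum_(0 <= k < m) e k <= 0) ->
  c n * (\sum_(0 <= k < n.+1) e k) <= \sum_(0 <= k < n.+1) c k * e k.
Proof.
elim: n => [|n IHn] cmono esum; first by rewrite !big_nat1.
rewrite big_nat_recr //= [leRHS]big_nat_recr //= mulrDr lerD2r.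
apply: le_trans (IHn _ _); last 2 first.
- by move=> i ltin; rewrite cmono // ltnW.
- by move=> m lemn; rewrite esum // ltnW.
by rewrite ler_wnM2r ?cmono ?esum.
Qed.

(** Summing the tangent inequalities at the points [y k] leaves [f' (y k) * (x k - y k)], whose sum
    is nonpositive by Abel summation, since [f' (y k)] increases with [k]. Tangents exist only at
    positive points, so the induction on [d] strips the zeros at the end of [y]. *)
Lemma karamata_tangent (R : realDomainType) (f f' : R -> R) (d : nat)
    (x y : nat -> R) :
  (forall a b, 0 < a -> 0 <= b -> f b <= f a + f' a * (b - a)) ->
  (forall a b, 0 < a -> a <= b -> f' b <= f' a) ->
  (forall i, (i < d)%N -> 0 <= x i) ->
  (forall i, (i < d)%N -> 0 <= y i) ->
  (forall i, (i.+1 < d)%N -> y i.+1 <= y i) ->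
  (forall m, (m <= d)%N -> \sum_(0 <= k < m) y k <= \sum_(0 <= k < m) x k) ->
  \sum_(0 <= k < d) y k = \sum_(0 <= k < d) x k ->
  \sum_(0 <= k < d) f (x k) <= \sum_(0 <= k < d) f (y k).
Proof.
move=> ftan f'anti; elim: d => [|d IHd] x_ge0 y_ge0 ymono maj eqs.
  by rewrite !big_geq.
have := y_ge0 d (ltnSn d); rewrite le_eqVlt => /predU1P[/esym yd0|yd_gt0].
  have majd := maj d (leqnSn d).
  move: (eqs); rewrite !big_nat_recr //= yd0 addr0 => eqsd.
  (* Equal totals and majorization of the first [d] terms leave no mass for [x d]. *)
  have xd0 : x d = 0.
    by apply/le_anti; rewrite x_ge0 // andbT; move: majd; rewrite eqsd; lra.
  rewrite xd0 lerD2r IHd //.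
  - by move=> i ltid; rewrite x_ge0 // ltnW.
  - by move=> i ltid; rewrite y_ge0 // ltnW.
  - by move=> i ltid; rewrite ymono // ltnW.
  - by move=> m lemd; rewrite maj // ltnW.
  - by rewrite eqsd xd0 addr0.
have y_gt0 i : (i <= d)%N -> 0 < y i.
  suff ydec k : (i + k <= d)%N -> y (i + k)%N <= y i.
    by move=> leid; apply: lt_le_trans yd_gt0 _; rewrite -(subnKC leid) ydec ?subnKC.
  elim: k => [|k IHk]; first by rewrite addn0.
  rewrite addnS => lt_ik_d; apply: le_trans (IHk (ltnW lt_ik_d)).
  exact: ymono.
(* The lower bound from Abel summation is the last slope times the total of [y k - x k], which is
   zero. *)
have abel : 0 <= \sum_(0 <= k < d.+1) f' (y k) * (y k - x k).
  apply: le_trans (sumrM_ge_partial_sums _ _) => [|i ltid|m lemd].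
  - by rewrite sumrB eqs subrr mulr0.
  - by rewrite f'anti ?ymono ?y_gt0.
  - by rewrite sumrB subr_le0 maj // ltnW.
rewrite -subr_ge0 -sumrB; apply: le_trans abel _.
rewrite !big_mkord; apply: ler_sum => i _.
have := ftan (y i) (x i) (y_gt0 i (ltn_ord i)) (x_ge0 i (ltn_ord i)); lra.
Qed.

(** * Reduction of traces to sums over the spectrum *)

Lemma mulVmx_conj_exp (R : comUnitRingType) (d n : nat) (U : 'M[R]_d)
    (e : 'rV[R]_d) : U \in unitmx ->
  (invmx U *m diag_mx e *m U) ^+ n
    = invmx U *m diag_mx (\row_j e 0 j ^+ n) *m U.
Proof.
move=> Uunit; elim: n => [|n IHn].
  have -> : diag_mx (\row_j e 0 j ^+ 0) = 1%:M.
    by rewrite -diag_const_mx; congr diag_mx; apply/rowP => j; rewrite !mxE expr0.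
  by rewrite expr0 mulmx1 mulVmx.
rewrite exprS IHn -[_ * _]/(_ *m _) !mulmxA mulmxK // -!mulmxA; congr (_ *m _).
rewrite mulmxA mulmx_diag; congr (diag_mx _ *m _).
by apply/rowP => j; rewrite !mxE exprS.
Qed.

Section Spectrum.
Local Open Scope complex_scope.
Local Open Scope sesquilinear_scope.
Variables (R : realType) (d : nat).
Implicit Types A rho : 'M[R[i]]_d.

Definition spectrum A (j : 'I_d) : R := complex.Re (spectral_diag A 0 j).

Lemma posSemidef_spectral_diag_ge0 A j : posSemidef A -> 0 <= spectral_diag A 0 j.
Proof.
move=> [/hermitian_normalmx/orthomx_spectralP A_eq Apos].
set U := spectralmx A in A_eq; set D := spectral_diag A in A_eq *.
have Uunitary : U \is unitarymx by apply: spectral_unitarymx.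
have Uunit : U \in unitmx by apply: spectral_unit.
(* The test vector is the [j]-th eigenvector; the quadratic form at it is the eigenvalue [D 0 j]. *)
have /= := Apos (invmx U *m delta_mx j 0); rewrite {1}A_eq.
rewrite invmx_unitary // trmx_mul map_mxM /= trmxCK -invmx_unitary //.
rewrite !mulmxA mulmxK // mulmxK //.
rewrite -mulmxA mul_diag_mx trmx_delta map_delta_mx -rowE !mxE.
by rewrite !eqxx mulr1.
Qed.

Lemma posSemidef_spectral_diagE A j : posSemidef A ->
  spectral_diag A 0 j = (spectrum A j)%:C.
Proof.
move/(posSemidef_spectral_diag_ge0 j); rewrite /spectrum.
by case: (spectral_diag A 0 j) => a b; rewrite lecE /= => /andP[/eqP -> _].
Qed.

Lemma spectrum_ge0 A j : posSemidef A -> 0 <= spectrum A j.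
Proof.
move=> Apos; have := posSemidef_spectral_diag_ge0 j Apos.
by rewrite posSemidef_spectral_diagE // ler0c.
Qed.

Lemma posSemidef_spectrumE A : posSemidef A ->
  A = invmx (spectralmx A) *m diag_mx (\row_j (spectrum A j)%:C) *m spectralmx A.
Proof.
move=> Apos; have /orthomx_spectralP {1}-> := hermitian_normalmx Apos.1.
congr (_ *m diag_mx _ *m _); apply/rowP => j.
by rewrite mxE posSemidef_spectral_diagE.
Qed.

Lemma mxtrace_conj_real (U : 'M[R[i]]_d) (e : 'I_d -> R) : U \in unitmx ->
  \tr (invmx U *m diag_mx (\row_j (e j)%:C) *m U) = (\sum_j e j)%:C.
Proof.
move=> Uunit; rewrite mxtrace_mulC mulKVmx // mxtrace_diag rmorph_sum.
by apply: eq_bigr => j _; rewrite mxE.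
Qed.

Lemma densityMatrix_sum_spectrum rho : densityMatrix rho -> \sum_j spectrum rho j = 1.
Proof.
move=> [rho_pos]; rewrite {1}(posSemidef_spectrumE rho_pos).
by rewrite mxtrace_conj_real ?spectral_unit // => -[].
Qed.

(** Every factor, the scalar matrix included, is diagonal in the eigenbasis of [rho], so sums,
    powers and products are taken entrywise. *)
Lemma entropyMomentE (n : nat) rho : posSemidef rho ->
  entropyMoment n rho
    = (\sum_j spectrum rho j * (- ln (spectrum rho j) + (n%:R - 1)) ^+ n)
      - (n%:R - 1) ^+ n.
Proof.
move=> rho_pos; rewrite /entropyMoment /logMx /funMx.
set U := spectralmx rho; have Uunit : U \in unitmx by apply: spectral_unit.
set c : R := n%:R - 1.
have -> : ((n%:R - 1)%:M : 'M[R[i]]_d)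
    = invmx U *m diag_mx (\row_j c%:C) *m U.
  have -> : diag_mx (\row_j c%:C) = (n%:R - 1)%:M :> 'M[R[i]]_d.
    rewrite -diag_const_mx; congr diag_mx; apply/rowP => j; rewrite !mxE /c.
    by rewrite rmorphB rmorph_nat rmorph1.
  by rewrite -mulmxA mul_scalar_mx -scalemxAr mulVmx // scalemx1.
rewrite -mulNmx -mulmxN -mulmxDl -mulmxDr -raddfN -raddfD.
rewrite mulVmx_conj_exp // [X in X *m _](posSemidef_spectrumE rho_pos) -/U.
rewrite !mulmxA mulmxK // -[_ *m diag_mx _ *m diag_mx _]mulmxA mulmx_diag.
set e := \row_j _.
have -> : e = \row_j (spectrum rho j * (- ln (spectrum rho j) + c) ^+ n)%:C.
  apply/rowP => j; rewrite !mxE -/(spectrum rho j).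
  by rewrite -rmorphN -rmorphD -rmorphXn -rmorphM.
by rewrite mxtrace_conj_real.
Qed.

Lemma size_eigenvalues A : size (eigenvalues A) = d.
Proof. by rewrite size_sort size_map size_enum_ord. Qed.

Lemma sum_eigenvalues (f : R -> R) A :
  \sum_(0 <= k < d) f (eigenvalues A)`_k = \sum_j f (spectrum A j).
Proof.
transitivity (\sum_(x <- eigenvalues A) f x).
  by rewrite [RHS](big_nth 0) size_eigenvalues.
rewrite (perm_big [seq spectrum A j | j <- enum 'I_d]) /=.
  by rewrite big_map big_enum.
by rewrite perm_sort.
Qed.

Lemma eigenvalues_ge0 A k : posSemidef A -> 0 <= (eigenvalues A)`_k.
Proof.
move=> Apos; have [ltk|lek] := ltnP k (size (eigenvalues A)); last by rewrite nth_default.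
have := mem_nth 0 ltk; rewrite mem_sort => /mapP[j _ ->].
exact: spectrum_ge0.
Qed.

Lemma eigenvalues_nincr A k : (k.+1 < d)%N ->
  (eigenvalues A)`_k.+1 <= (eigenvalues A)`_k.
Proof.
move=> ltk.
have srt : sorted (fun x y : R => y <= x) (eigenvalues A).
  by apply: sort_sorted => x y; apply: le_total.
have trans : transitive (fun x y : R => y <= x).
  by move=> y x z leyx lezy; apply: le_trans leyx.
by apply: (sorted_ltn_nth trans 0 srt); rewrite ?inE ?size_eigenvalues // ltnW.
Qed.

End Spectrum.

(** * From the cubic entropy to the moments *)

Section MajorizationInequality.
Variables (R : realType) (d : nat).
Implicit Types rho sigma : 'M[R[i]]_d.

(** With [L = - ln x], the cubic in [s + L] is expanded in [(L + 2) ^+ 3], [(L + 1) ^+ 2], [L] and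
    [1], the shifted powers in the moments. The last summand is the same for all density matrices,
    so it cancels in differences. *)
Lemma sum_cubicEntropy_spectrum (s : R) rho : densityMatrix rho ->
  \sum_j cubicEntropy s (spectrum rho j)
    = entropyMoment 3 rho + (3 * s - 3) * entropyMoment 2 rho
      + 3 * s ^+ 2 * entropyMoment 1 rho + (s ^+ 3 + 3 * s ^+ 2 + 6 * s + 6).
Proof.
move=> rho_dens; have [rho_pos _] := rho_dens.
set m := fun n => \sum_j spectrum rho j * (- ln (spectrum rho j) + (n%:R - 1)) ^+ n.
transitivity (m 3 + (3 * s - 3) * m 2 + 3 * s ^+ 2 * m 1
    + (s + 1) ^+ 3 * \sum_j spectrum rho j).
  rewrite /m !mulr_sumr -!big_split; apply: eq_bigr => j _ /=.
  rewrite /cubicEntropy; ring.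
rewrite densityMatrix_sum_spectrum // !entropyMomentE // -/(m 1) -/(m 2) -/(m 3).
ring.
Qed.

Lemma le_sum_cubicEntropy (s : R) rho sigma :
  densityMatrix rho -> densityMatrix sigma -> majorizes rho sigma ->
  \sum_j cubicEntropy s (spectrum rho j)
    <= \sum_j cubicEntropy s (spectrum sigma j).
Proof.
move=> rho_dens sigma_dens maj; rewrite -!sum_eigenvalues.
apply: (karamata_tangent (f' := fun x => (s - ln x) ^+ 3)).
- exact: cubicEntropy_tangent.
- move=> a b a_gt0 leab; rewrite ler_cube // lerD2l lerN2 ler_ln ?posrE //.
  exact: lt_le_trans leab.
- by move=> i _; apply: eigenvalues_ge0; case: rho_dens.
- by move=> i _; apply: eigenvalues_ge0; case: sigma_dens.
- exact: eigenvalues_nincr.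
(* [majorizes] starts at [m = 1]; the empty sums are treated apart. *)
- by case=> [|m] lemd; [rewrite !big_geq | apply: maj].
- by rewrite !(sum_eigenvalues id) !densityMatrix_sum_spectrum.
Qed.

End MajorizationInequality.

Theorem mainTheorem5 (R : realType) (d : nat) (rho sigma : 'M[R[i]]_d)
    (hrho : densityMatrix rho) (hsigma : densityMatrix sigma)
    (hmaj : majorizes rho sigma) :
  let DeltaM (n : nat) : R := entropyMoment n sigma - entropyMoment n rho in
  DeltaM 1%N != 0 ->
  DeltaM 3%N >= 3 * DeltaM 2%N + 3 / 4 * (DeltaM 2%N ^+ 2 / DeltaM 1%N).
Proof.
(* This [s] is the critical point of the quadratic [DeltaM 3 + (3 * s - 3) * DeltaM 2 + 3 * s ^+ 2 *
   DeltaM 1]. Its value there is exactly the difference of the two sides of the claim, whatever the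
   sign of [DeltaM 1]. *)
move=> DeltaM DM1_neq0; pose s := - (DeltaM 2 / DeltaM 1 / 2).
have := le_sum_cubicEntropy s hrho hsigma hmaj.
rewrite !sum_cubicEntropy_spectrum // -subr_ge0 => Dg_ge0; rewrite -subr_ge0.
apply: le_trans Dg_ge0 _; rewrite le_eqVlt; apply/orP; left; apply/eqP.
transitivity (DeltaM 3 + (3 * s - 3) * DeltaM 2 + 3 * s ^+ 2 * DeltaM 1).
  (* Generalized first: [ring] unfolds the moments when it compares atoms. *)
  rewrite /DeltaM; clear; move: s (entropyMoment 1 rho) (entropyMoment 1 sigma).
  move: (entropyMoment 2 rho) (entropyMoment 2 sigma).
  move: (entropyMoment 3 rho) (entropyMoment 3 sigma) => *; ring.
rewrite /s; move: DM1_neq0; move: (DeltaM 1) (DeltaM 2) (DeltaM 3) => *.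
by field.
Qed.
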